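(* Let $G$ be a finite group, $H$ a subgroup of $G$ with $n$ elements, and $B_0=\mathbb C G$ the group algebra of $G$ with canonical embedding $p\mapsto\lambda_p$, involution $\lambda_p^*=\lambda_{p^{-1}}$ and coproduct $\Delta_0(\lambda_p)=\lambda_p\otimes\lambda_p$. Let $u=\frac1n\sum_{h\in H}\lambda_h$ (a self-adjoint idempotent). Let $B$ be the subalgebra of $B_0$ of elements $ubu$ with $b\in B_0$ (with unit $u$), and define $\Delta$ on $B$ by $\Delta(b)=(u\otimes u)\Delta_0(b)(u\otimes u)$. Then $(B,\Delta)$ is a finite $^*$-quantum hypergroup.
   Context: A coproduct on a finite-dimensional unital algebra $A$ over $\mathbb C$ is a linear map $\Delta:A\to A\otimes A$ with $(\Delta\otimes\iota)\Delta=(\iota\otimes\Delta)\Delta$ (not assumed multiplicative); $\iota$ is the identity map. A counit is a linear map $\varepsilon:A\to\mathbb C$ with $(\varepsilon\otimes\iota)\Delta(a)=a=(\iota\otimes\varepsilon)\Delta(a)$ for all $a$. A linear functional $\omega$ on $A$ is faithful if $\omega(ac)=0$ for all $c$ implies $a=0$, and $\omega(ac)=0$ for all $a$ implies $c=0$. A linear functional $\varphi$ on $A$ is a left integral if there is a linear map $S:A\to A$ with $S((\iota\otimes\varphi)(\Delta(a)(1\otimes c)))=(\iota\otimes\varphi)((1\otimes a)\Delta(c))$ for all $a,c\in A$. If $\varphi$ is faithful, $S$ is unique and called the antipode of $\varphi$. A finite quantum hypergroup is a pair $(A,\Delta)$ of a finite-dimensional unital algebra $A$ with a coproduct admitting a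 counit, such that there is a faithful left integral on $A$, $\Delta(1)=1\otimes1$ (with $1$ the unit of $A$), the counit is an algebra homomorphism, and the antipode of the integral is an anti-isomorphism of the algebra $A$. It is a finite $^*$-quantum hypergroup if moreover $A$ is a $^*$-algebra and $\Delta(a^* )=\Delta(a)^*$ for all $a$. *)

(* Defs.v *)
From HB Require Import structures.
From mathcomp Require Import all_boot all_order all_fingroup all_algebra all_field.
From mathcomp Require Import complex reals.

Set Implicit Arguments.
Unset Strict Implicit.
Unset Printing Implicit Defensive.

Import GRing.Theory Num.Theory.
Local Open Scope ring_scope.

(** * Tensor products of finite-dimensional vector spaces

   [tens U V] is [U (x) V] in coordinates: the entry [t i j] is the coefficient
   of [evec i \ot evec j], where [evec] is the basis [vbasis fullv].  Lemmas
   [tliftE], [tlift_tpure] and [tens_ind] below give the universal property: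
   a bilinear map factors uniquely through [\ot]. *)

Section Tensor.
Variable K : fieldType.

Definition tens (U V : vectType K) : Type := 'M[K]_(\dim {:U}, \dim {:V}).

HB.instance Definition _ (U V : vectType K) :=
  Vector.copy (tens U V) 'M[K]_(\dim {:U}, \dim {:V}).

Definition evec (U : vectType K) (i : 'I_(\dim {:U})) : U := (vbasis {:U})`_i.
Definition ecoord (U : vectType K) (i : 'I_(\dim {:U})) (u : U) : K :=
  coord (vbasis {:U}) i u.

Definition tpure (U V : vectType K) (u : U) (v : V) : tens U V :=
  \matrix_(i, j) (ecoord i u * ecoord j v).

(* Linear for every [f], and the linear extension of [f] when [f] is bilinear. *)
Definition tlift (U V W : vectType K) (f : U -> V -> W) (t : tens U V) : W :=
  \sum_i \sum_j t i j *: f (evec i) (evec j).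

End Tensor.

Notation "u \ot v" := (tpure u v) (at level 40, left associativity).

Section TensorTheory.
Variable K : fieldType.
Implicit Types U V W : vectType K.

Lemma tlift_is_linear U V W (f : U -> V -> W) : linear (tlift f).
Proof.
move=> k x y; rewrite /tlift scaler_sumr -big_split /=; apply: eq_bigr => i _.
rewrite scaler_sumr -big_split /=; apply: eq_bigr => j _.
by rewrite !mxE scalerDl scalerA.
Qed.
HB.instance Definition _ U V W (f : U -> V -> W) :=
  GRing.isLinear.Build K (tens U V) W _ (tlift f) (tlift_is_linear f).

Lemma tlift_linearf U V W (f g h : U -> V -> W) k (t : tens U V) :
  (forall u v, f u v = k *: g u v + h u v) ->
  tlift f t = k *: tlift g t + tlift h t.
Proof.
move=> fE; rewrite /tlift scaler_sumr -big_split /=; apply: eq_bigr => i _.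
rewrite scaler_sumr -big_split /=; apply: eq_bigr => j _.
by rewrite fE scalerDr !scalerA mulrC.
Qed.

Lemma evecE U (u : U) : u = \sum_i ecoord i u *: evec i.
Proof. exact: coord_vbasis (memvf u). Qed.

Lemma ecoord_linear U i : linear (@ecoord K U i : U -> K^o).
Proof. by move=> k x y; rewrite /ecoord linearP. Qed.

Lemma tliftE U V W (f : U -> V -> W) (u : U) (v : V) :
  (forall v, linear (f^~ v)) -> (forall u, linear (f u)) ->
  tlift f (u \ot v) = f u v.
Proof.
move=> fl fr.
pose fL v' : {linear U -> W} := HB.pack (f^~ v') (GRing.isLinear.Build _ _ _ _ _ (fl v')).
pose fR u' : {linear V -> W} := HB.pack (f u') (GRing.isLinear.Build _ _ _ _ _ (fr u')).
rewrite -[RHS]/(fL v u) [in RHS](evecE u) linear_sum /tlift.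
apply: eq_bigr => i _; rewrite linearZ_LR -[fL v _]/(fR (evec i) v).
rewrite [in RHS](evecE v) linear_sum scaler_sumr.
by apply: eq_bigr => j _; rewrite linearZ /= scalerA mxE.
Qed.

Lemma tpure_linearl U V (v : V) : linear (fun u : U => u \ot v).
Proof.
move=> k x y; apply/matrixP=> i j.
by rewrite !mxE ecoord_linear mulrDl -mulrA.
Qed.
Lemma tpure_linearr U V (u : U) : linear (fun v : V => u \ot v).
Proof.
move=> k x y; apply/matrixP=> i j.
by rewrite !mxE ecoord_linear mulrDr mulrCA.
Qed.

Lemma ecoord_evec U (i j : 'I_(\dim {:U})) : ecoord i (evec j : U) = (i == j)%:R.
Proof. by rewrite /ecoord /evec coord_free ?(basis_free (vbasisP _)) // eq_sym. Qed.

Lemma tlift_tpure U V (t : tens U V) : tlift (@tpure K U V) t = t.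
Proof.
rewrite /tlift [RHS]matrix_sum_delta; apply: eq_bigr => i _; apply: eq_bigr => j _.
by congr (_ *: _); apply/matrixP=> a b; rewrite !mxE !ecoord_evec -natrM mulnb.
Qed.

Lemma tens_ind U V (P : tens U V -> Prop) :
  P 0 -> (forall k x y, P x -> P y -> P (k *: x + y)) ->
  (forall u v, P (u \ot v)) -> forall t, P t.
Proof.
move=> P0 Plin Pp t; rewrite -[t]tlift_tpure.
have Psum (I : finType) (F : I -> tens U V) : (forall i, P (F i)) -> P (\sum_i F i).
  by move=> PF; apply: big_ind => // x y Px Py; rewrite -[x]scale1r; apply: Plin.
apply: (Psum _) => i; apply: (Psum _) => j.
by rewrite -[_ *: _]addr0; apply: Plin.
Qed.

Lemma tpure_neq0 U V (u : U) (v : V) : u != 0 -> v != 0 -> u \ot v != 0.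
Proof.
have nz (X : vectType K) (x : X) : x != 0 -> exists i, ecoord i x != 0.
  move=> nzx; apply/existsP; apply: contraR nzx; rewrite negb_exists => /forallP h.
  rewrite [x]evecE big1 // => i _; have := h i; rewrite negbK => /eqP ->.
  by rewrite scale0r.
move=> /nz [i ui] /nz [j vj]; apply/eqP => /matrixP /(_ i j) /eqP.
by rewrite !mxE mulf_eq0 (negbTE ui) (negbTE vj).
Qed.

Definition tmap U V U' V' (f : U -> U') (g : V -> V') : tens U V -> tens U' V' :=
  tlift (fun u v => f u \ot g v).
HB.instance Definition _ U V U' V' (f : U -> U') (g : V -> V') :=
  GRing.Linear.copy (tmap f g) (tlift (fun u v => f u \ot g v)).

Lemma tmapE U V U' V' (f : {linear U -> U'}) (g : {linear V -> V'}) u v :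
  tmap f g (u \ot v) = f u \ot g v.
Proof.
apply: tliftE => w k x y /=; rewrite linearP.
  by rewrite -/(_ \ot _) tpure_linearl.
by rewrite tpure_linearr.
Qed.

Definition tassoc U V W : tens (tens U V) W -> tens U (tens V W) :=
  tlift (fun t w => tlift (fun u v => u \ot (v \ot w)) t).
HB.instance Definition _ U V W :=
  GRing.Linear.copy (@tassoc U V W)
    (tlift (fun t w => tlift (fun u v => u \ot (v \ot w)) t)).

Lemma tassocE U V W (u : U) (v : V) (w : W) :
  tassoc ((u \ot v) \ot w) = u \ot (v \ot w).
Proof.
have lin1 (w' : W) : tlift (fun u v => u \ot (v \ot w')) (u \ot v) = u \ot (v \ot w').
  by apply: tliftE => z k x y; rewrite ?tpure_linearl ?tpure_linearr.
rewrite -lin1; apply: tliftE => z k x y /=; first by rewrite linearP.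
apply: tlift_linearf => u' v'; by rewrite !tpure_linearr.
Qed.

(* The slice maps [iota (x) w] and [w (x) iota] of a functional [w]. *)
Definition tslicer U V (w : V -> K) : tens U V -> U :=
  tlift (fun u v => w v *: u).
HB.instance Definition _ U V (w : V -> K) :=
  GRing.Linear.copy (@tslicer U V w) (tlift (fun u v => w v *: u)).
Definition tslicel U V (w : U -> K) : tens U V -> V :=
  tlift (fun u v => w u *: v).
HB.instance Definition _ U V (w : U -> K) :=
  GRing.Linear.copy (@tslicel U V w) (tlift (fun u v => w u *: v)).

Lemma tslicerE U V (w : {scalar V}) (u : U) v : tslicer w (u \ot v) = w v *: u.
Proof.
apply: tliftE => z k x y /=; first by rewrite scalerDr !scalerA mulrC.
by rewrite linearP scalerDl scalerA.
Qed.
Lemma tslicelE U V (w : {scalar U}) u (v : V) : tslicel w (u \ot v) = w u *: v.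
Proof.
apply: tliftE => z k x y /=; last by rewrite scalerDr !scalerA mulrC.
by rewrite linearP scalerDl scalerA.
Qed.

End TensorTheory.

(** * The tensor product algebra *)

Section TensorAlgebra.
Variables (K : fieldType) (A B : falgType K).
Implicit Types x y z : tens A B.

Definition tmul x y : tens A B :=
  tlift (fun a b => tlift (fun c d => (a * c) \ot (b * d)) y) x.

Lemma tmul_linearl y : linear (tmul^~ y).
Proof. by move=> k x x'; rewrite /tmul linearP. Qed.

Lemma tmul_linearr x : linear (tmul x).
Proof.
by move=> k y y'; apply: tlift_linearf => a b; rewrite linearP.
Qed.

Lemma tmulE a b c d : tmul (a \ot b) (c \ot d) = (a * c) \ot (b * d).
Proof.
have in_lin a' b' : tlift (fun c d => (a' * c) \ot (b' * d)) (c \ot d)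
                  = (a' * c) \ot (b' * d).
  by apply: tliftE => z k x y /=; rewrite mulrDr -scalerAr
    ?tpure_linearl ?tpure_linearr.
rewrite -in_lin; apply: tliftE => z k x y /=; rewrite !in_lin mulrDl -scalerAl.
  by rewrite tpure_linearl.
by rewrite tpure_linearr.
Qed.

Lemma tmul0l y : tmul 0 y = 0.
Proof. by rewrite /tmul linear0. Qed.
Lemma tmul0r x : tmul x 0 = 0.
Proof. by have := tmul_linearr x (-1) 0 0; rewrite scaler0 addr0 scaleN1r addNr. Qed.

Lemma tmulA : associative tmul.
Proof.
move=> x y z.
elim/tens_ind: x => [|k x x' IH IH'|a b]; first by rewrite !tmul0l.
  by rewrite !tmul_linearl IH IH'.
elim/tens_ind: y => [|k x x' IH IH'|c d]; first by rewrite !(tmul0l, tmul0r).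
  by rewrite !(tmul_linearr, tmul_linearl) IH IH'.
elim/tens_ind: z => [|k x x' IH IH'|e f]; first by rewrite !tmul0r.
  by rewrite !tmul_linearr IH IH'.
by rewrite !tmulE !mulrA.
Qed.

Lemma tmul1l : left_id (1 \ot 1) tmul.
Proof.
move=> x; elim/tens_ind: x => [|k x x' IH IH'|a b]; first by rewrite tmul0r.
  by rewrite tmul_linearr IH IH'.
by rewrite tmulE !mul1r.
Qed.
Lemma tmul1r : right_id (1 \ot 1) tmul.
Proof.
move=> x; elim/tens_ind: x => [|k x x' IH IH'|a b]; first by rewrite tmul0l.
  by rewrite tmul_linearl IH IH'.
by rewrite tmulE !mulr1.
Qed.
Lemma tmulDl : left_distributive tmul +%R.
Proof. by move=> x x' y; have := tmul_linearl y 1 x x'; rewrite !scale1r. Qed.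
Lemma tmulDr : right_distributive tmul +%R.
Proof. by move=> x y y'; have := tmul_linearr x 1 y y'; rewrite !scale1r. Qed.
Lemma tone_neq0 : (1 \ot 1 : tens A B) != 0.
Proof. by apply: tpure_neq0; exact: oner_neq0. Qed.

HB.instance Definition _ := GRing.Zmodule_isNzRing.Build (tens A B)
  tmulA tmul1l tmul1r tmulDl tmulDr tone_neq0.

Lemma tscaleAl k x y : k *: (x * y) = (k *: x) * y.
Proof. by have := tmul_linearl y k x 0; rewrite tmul0l !addr0. Qed.
Lemma tscaleAr k x y : k *: (x * y) = x * (k *: y).
Proof. by have := tmul_linearr x k y 0; rewrite tmul0r !addr0. Qed.

HB.instance Definition _ :=
  GRing.Lmodule_isLalgebra.Build K (tens A B) tscaleAl.
HB.instance Definition _ :=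
  GRing.Lalgebra_isAlgebra.Build K (tens A B) tscaleAr.
HB.instance Definition _ := Algebra_isFalgebra.Build K (tens A B).

Lemma tpureM a b c d : (a \ot b : tens A B) * (c \ot d) = (a * c) \ot (b * d).
Proof. exact: tmulE. Qed.
Lemma tpure1 : (1 : tens A B) = 1 \ot 1. Proof. by []. Qed.

End TensorAlgebra.

(** * Finite quantum hypergroups *)

Section QuantumHypergroup.
Variables (C : fieldType) (A : falgType C) (Delta : {linear A -> tens A A}).

Definition coassociative : Prop :=
  forall a, tassoc (tmap Delta idfun (Delta a)) = tmap idfun Delta (Delta a).

Definition counit (eps : {scalar A}) : Prop :=
  forall a, tslicel eps (Delta a) = a /\ tslicer eps (Delta a) = a.

Definition faithful (omega : {scalar A}) : Prop :=
  (forall a, (forall c, omega (a * c) = 0) -> a = 0) /\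
  (forall c, (forall a, omega (a * c) = 0) -> c = 0).

Definition antipode (phi : {scalar A}) (S : {linear A -> A}) : Prop :=
  forall a c, S (tslicer phi (Delta a * (1 \ot c)))
            = tslicer phi ((1 \ot a) * Delta c).

Definition left_integral (phi : {scalar A}) : Prop :=
  exists S : {linear A -> A}, antipode phi S.

Definition anti_isomorphism (S : {linear A -> A}) : Prop :=
  bijective S /\ forall a b, S (a * b) = S b * S a.

Definition finite_quantum_hypergroup : Prop :=
  [/\ coassociative,
      exists eps, counit eps,
      Delta 1 = 1 \ot 1,
      forall eps, counit eps -> monoid_morphism eps
    & exists phi, [/\ faithful phi, left_integral phi
        & forall S, antipode phi S -> anti_isomorphism S]].

End QuantumHypergroup.

Section StarQuantumHypergroup.
Variables (C : numClosedFieldType) (A : falgType C).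

Definition star_operation (s : A -> A) : Prop :=
  [/\ forall (k : C) a b, s (k *: a + b) = k^* *: s a + s b,
      forall a b, s (a * b) = s b * s a
    & involutive s].

(* The antilinear extension of [(a \ot b)^* = a^* \ot b^*]. *)
Definition tstar (s : A -> A) (t : tens A A) : tens A A :=
  \sum_i \sum_j (t i j)^* *: (s (evec i) \ot s (evec j)).

Lemma tstarE (s : A -> A) a b : star_operation s ->
  tstar s (a \ot b) = s a \ot s b.
Proof.
case=> sl _ _.
have s0 : s 0 = 0 by have := sl (-1) 0 0;
  rewrite scaler0 addr0 rmorphN1 scaleN1r addNr.
have sD x y : s (x + y) = s x + s y.
  by rewrite -[x]scale1r sl rmorph1 !scale1r.
have sE (v : A) : s v = \sum_i (ecoord i v)^* *: s (evec i).
  rewrite [in LHS](evecE v) (big_morph s sD s0); apply: eq_bigr => i _.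
  by rewrite -[_ *: evec i]addr0 sl s0 addr0.
have sumZ (V W : vectType C) (f : {linear V -> W}) (x : 'I_(\dim {:A}) -> C) y :
    f (\sum_i x i *: y i) = \sum_i x i *: f (y i).
  by rewrite linear_sum; apply: eq_bigr => i _; rewrite linearZ.
pose L v := HB.pack_for {linear A -> tens A A} (fun u : A => u \ot v)
  (GRing.isLinear.Build _ _ _ _ _ (@tpure_linearl _ A A v)).
pose R u := HB.pack_for {linear A -> tens A A} (fun v : A => u \ot v)
  (GRing.isLinear.Build _ _ _ _ _ (@tpure_linearr _ A A u)).
rewrite [in RHS](sE a) -[RHS]/(L (s b) _) sumZ.
apply: eq_bigr => i _; rewrite -[L (s b) _]/(R (s (evec i)) (s b)).
rewrite (sE b) sumZ scaler_sumr; apply: eq_bigr => j _.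
by rewrite scalerA mxE rmorphM.
Qed.

Definition finite_star_quantum_hypergroup
    (s : A -> A) (Delta : {linear A -> tens A A}) : Prop :=
  [/\ finite_quantum_hypergroup Delta, star_operation s
    & forall a, Delta (s a) = tstar s (Delta a)].

End StarQuantumHypergroup.

(** * The group algebra *)

Section GroupAlgebra.
Variables (C : fieldType) (gT : finGroupType).

(* An element is its coefficient function; the product is convolution. *)
Definition grAlg : Type := {ffun gT -> C^o}.
HB.instance Definition _ := Vector.copy grAlg {ffun gT -> C^o}.

Implicit Types x y z : grAlg.

Definition coef (x : grAlg) (g : gT) : C := (x : {ffun gT -> C^o}) g.
Definition lam (p : gT) : grAlg := [ffun g => (g == p)%:R : C^o].
Definition gmul x y : grAlg :=
  [ffun g => \sum_h coef x h * coef y (h^-1 * g)%g : C^o].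

Lemma grAlgP x y : (forall g, coef x g = coef y g) -> x = y.
Proof. by move=> h; apply/ffunP => g; apply: h. Qed.
Lemma coefD x y g : coef (x + y) g = coef x g + coef y g.
Proof. by rewrite /coef ffunE. Qed.
Lemma coefZ k x g : coef (k *: x) g = k * coef x g.
Proof. by rewrite /coef ffunE. Qed.
Lemma coef_lam p g : coef (lam p) g = (g == p)%:R.
Proof. by rewrite /coef ffunE. Qed.
Lemma coef_gmul x y g : coef (gmul x y) g = \sum_h coef x h * coef y (h^-1 * g)%g.
Proof. by rewrite /coef ffunE. Qed.

Lemma gmulA : associative gmul.
Proof.
move=> x y z; apply: grAlgP => g; rewrite !coef_gmul.
under eq_bigr => h _ do rewrite coef_gmul mulr_sumr.
under [RHS]eq_bigr => h _ do rewrite coef_gmul mulr_suml.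
rewrite [RHS]exchange_big; apply: eq_bigr => h _ /=.
rewrite [RHS](reindex_inj (mulgI h)); apply: eq_bigr => k _.
by rewrite mulKg invMg !mulgA mulrA.
Qed.
Lemma gmul1l : left_id (lam 1) gmul.
Proof.
move=> x; apply: grAlgP => g; rewrite coef_gmul (bigD1 1%g) //= big1 => [|h /negbTE nh].
  by rewrite coef_lam eqxx mul1r invg1 mul1g addr0.
by rewrite coef_lam nh mul0r.
Qed.
Lemma gmul1r : right_id (lam 1) gmul.
Proof.
move=> x; apply: grAlgP => g; rewrite coef_gmul (bigD1 g) //= big1 => [|h nh].
  by rewrite coef_lam mulVg eqxx mulr1 addr0.
by rewrite coef_lam -eq_mulVg1 (negbTE nh) mulr0.
Qed.
Lemma gmulDl : left_distributive gmul +%R.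
Proof.
move=> x y z; apply: grAlgP => g; rewrite coefD !coef_gmul -big_split /=.
by apply: eq_bigr => h _; rewrite coefD mulrDl.
Qed.
Lemma gmulDr : right_distributive gmul +%R.
Proof.
move=> x y z; apply: grAlgP => g; rewrite coefD !coef_gmul -big_split /=.
by apply: eq_bigr => h _; rewrite coefD mulrDr.
Qed.
Lemma lam_neq0 p : lam p != 0.
Proof.
apply/eqP => /(congr1 (coef^~ p)); rewrite coef_lam eqxx /coef ffunE => /eqP.
by rewrite oner_eq0.
Qed.

HB.instance Definition _ := GRing.Zmodule_isNzRing.Build grAlg
  gmulA gmul1l gmul1r gmulDl gmulDr (lam_neq0 1).

Lemma coefM x y g : coef (x * y) g = \sum_h coef x h * coef y (h^-1 * g)%g.
Proof. exact: coef_gmul. Qed.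

Lemma gscaleAl k x y : k *: (x * y) = (k *: x) * y.
Proof.
apply: grAlgP => g; rewrite coefZ !coefM mulr_sumr.
by apply: eq_bigr => h _; rewrite coefZ mulrA.
Qed.
Lemma gscaleAr k x y : k *: (x * y) = x * (k *: y).
Proof.
apply: grAlgP => g; rewrite coefZ !coefM mulr_sumr.
by apply: eq_bigr => h _; rewrite coefZ mulrCA.
Qed.
HB.instance Definition _ := GRing.Lmodule_isLalgebra.Build C grAlg gscaleAl.
HB.instance Definition _ := GRing.Lalgebra_isAlgebra.Build C grAlg gscaleAr.
HB.instance Definition _ := Algebra_isFalgebra.Build C grAlg.

Lemma lam1 : lam 1 = 1. Proof. by []. Qed.
Lemma lamM p q : lam p * lam q = lam (p * q)%g.
Proof.
apply: grAlgP => g; rewrite coefM (bigD1 p) //= big1 => [|h /negbTE nh].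
  by rewrite !coef_lam eqxx mul1r addr0 (can2_eq (mulKVg p) (mulKg p)).
by rewrite coef_lam nh mul0r.
Qed.
Lemma grAlgE x : x = \sum_p coef x p *: lam p.
Proof.
apply: grAlgP => g; rewrite (big_morph (coef^~ g) (id1 := 0) (op1 := +%R)).
- rewrite (bigD1 g) //= big1 => [|h nh]; rewrite coefZ coef_lam.
    by rewrite eqxx mulr1 addr0.
  by rewrite eq_sym (negbTE nh) mulr0.
- by move=> y z; rewrite coefD.
by rewrite /coef ffunE.
Qed.

Definition Delta0 x : tens grAlg grAlg := \sum_p coef x p *: (lam p \ot lam p).

Lemma Delta0_linear : linear Delta0.
Proof.
move=> k x y; rewrite /Delta0 scaler_sumr -big_split /=.
by apply: eq_bigr => p _; rewrite coefD coefZ scalerDl scalerA.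
Qed.
HB.instance Definition _ :=
  GRing.isLinear.Build C grAlg (tens grAlg grAlg) _ Delta0 Delta0_linear.

Lemma Delta0_lam p : Delta0 (lam p) = lam p \ot lam p.
Proof.
rewrite /Delta0 (bigD1 p) //= big1 => [|h nh]; rewrite coef_lam.
  by rewrite eqxx scale1r addr0.
by rewrite (negbTE nh) scale0r.
Qed.

End GroupAlgebra.

Arguments lam {C gT} p.

Section StarGroupAlgebra.
Variables (C : numClosedFieldType) (gT : finGroupType).

Definition gstar (x : grAlg C gT) : grAlg C gT :=
  \sum_p (coef x p)^* *: lam p^-1.

Lemma gstar_lam p : gstar (lam p) = lam p^-1.
Proof.
rewrite /gstar (bigD1 p) //= big1 => [|h nh]; rewrite coef_lam.
  by rewrite eqxx rmorph1 scale1r addr0.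
by rewrite (negbTE nh) rmorph0 scale0r.
Qed.

Lemma coef_gstar x g : coef (gstar x) g = (coef x g^-1)^*.
Proof.
rewrite /gstar (big_morph ((@coef _ _)^~ g) (id1 := 0) (op1 := +%R)).
- rewrite (bigD1 g^-1%g) //= big1 => [|h nh]; rewrite coefZ coef_lam.
    by rewrite invgK eqxx mulr1 addr0.
  by rewrite -(inj_eq invg_inj) invgK eq_sym (negbTE nh) mulr0.
- by move=> y z; rewrite coefD.
by rewrite /coef ffunE.
Qed.

Lemma gstarM x y : gstar (x * y) = gstar y * gstar x :> grAlg C gT.
Proof.
apply: grAlgP => g; rewrite coef_gstar !coefM rmorph_sum /=.
rewrite (reindex_inj (mulgI g^-1%g)); apply: eq_bigr => h _.
by rewrite rmorphM !coef_gstar !invMg !invgK mulrC mulgK.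
Qed.

End StarGroupAlgebra.

(** * The compression of the group algebra by the averaging idempotent *)

Section Hecke.
Variables (C : numClosedFieldType) (gT : finGroupType) (H : {group gT}).

Definition avg : grAlg C gT := (#|H|%:R)^-1 *: \sum_(h in H) lam h.

Lemma lam_avg h : h \in H -> lam h * avg = avg.
Proof.
move=> Hh; rewrite /avg -scalerAr mulr_sumr; congr (_ *: _).
rewrite [RHS](reindex_inj (mulgI h)) /=; apply: eq_big => k.
  by rewrite groupMl.
by rewrite lamM.
Qed.

Lemma avg_idem : avg * avg = avg.
Proof.
rewrite {1}/avg -scalerAl mulr_suml.
under eq_bigr => h Hh do rewrite lam_avg //.
by rewrite sumr_const -scaler_nat scalerA mulVf ?scale1r // pnatr_eq0 -lt0n cardG_gt0.
Qed.

Lemma coef_avg g : coef avg g = (g \in H)%:R / #|H|%:R.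
Proof.
rewrite /avg coefZ mulrC; congr (_ * _).
rewrite (big_morph ((@coef _ _)^~ g) (id1 := 0) (op1 := +%R)); last 2 first.
- by move=> y z; rewrite coefD.
- by rewrite /coef ffunE.
under eq_bigr => h _ do rewrite coef_lam.
have [Hg|nHg] := boolP (g \in H).
  rewrite (bigD1 g) //= eqxx big1 ?addr0 // => h /andP[_ nh].
  by rewrite eq_sym (negbTE nh).
by rewrite big1 // => h Hh; case: eqP => // gh; rewrite gh Hh in nHg.
Qed.

Lemma avg_neq0 : avg != 0.
Proof.
apply/eqP => /(congr1 ((@coef _ _)^~ 1%g)); rewrite coef_avg group1 mul1r.
rewrite /coef ffunE => /eqP.
by rewrite invr_eq0 pnatr_eq0 -[_ == _]negbK -lt0n cardG_gt0.
Qed.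

Lemma gstar_avg : gstar avg = avg.
Proof.
apply: grAlgP => g; rewrite coef_gstar !coef_avg groupV.
by rewrite fmorph_div /= !conjC_nat.
Qed.

Definition compress (b : grAlg C gT) : grAlg C gT := avg * b * avg.

Lemma compress_linear : linear compress.
Proof.
move=> k x y; rewrite /compress; move: avg => u.
by rewrite mulrDr mulrDl -scalerAr -scalerAl.
Qed.
HB.instance Definition _ :=
  GRing.isLinear.Build C (grAlg C gT) (grAlg C gT) _ compress compress_linear.

Definition hecke_space : {vspace grAlg C gT} := limg (linfun compress).

Lemma hecke_spaceP x :
  reflect (exists b, x = compress b) (x \in hecke_space).
Proof.
apply: (iffP memv_imgP) => [[b _ ->]|[b ->]]; exists b; rewrite ?lfunE ?memvf //.
Qed.

Lemma compressK b : avg * compress b = compress b /\ compress b * avg = compress b.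
Proof. by rewrite /compress -!mulrA avg_idem !mulrA avg_idem. Qed.

Lemma hecke_algid : is_algid avg hecke_space.
Proof.
split; [|exact: avg_neq0|by move=> _ /hecke_spaceP[b ->]; exact: compressK].
by apply/hecke_spaceP; exists avg; rewrite /compress !avg_idem.
Qed.

Lemma hecke_is_aspace : is_aspace hecke_space.
Proof.
apply/andP; split; first by apply/has_algidP; exists avg; exact: hecke_algid.
apply/prodvP => _ _ /hecke_spaceP[b ->] /hecke_spaceP[c ->].
apply/hecke_spaceP; exists (b * avg * (avg * c)).
by rewrite /compress !mulrA.
Qed.

(* [subvs_of hecke] is the algebra of all [avg * b * avg]; its unit is [avg],
   not the unit of the group algebra (lemma [val_hecke1]). *)
Definition hecke : {aspace grAlg C gT} := ASpace hecke_is_aspace.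

Lemma val_hecke1 : vsval (1 : subvs_of hecke) = avg.
Proof.
have [Ha _ id_a] := hecke_algid.
have [e _] := id_a _ (memv_algid hecke).
by rewrite -[RHS](algidr (A := hecke) Ha) e.
Qed.

(* Both maps already take values in [hecke], resp. [hecke (x) hecke]; [vsproj]
   only restricts the codomain (lemmas [val_hecke_star], [val_hecke_Delta]). *)
Definition hecke_star (b : subvs_of hecke) : subvs_of hecke :=
  vsproj hecke (gstar (vsval b)).

Definition hecke_Delta (b : subvs_of hecke) : tens (subvs_of hecke) (subvs_of hecke) :=
  tmap (vsproj hecke) (vsproj hecke)
    ((avg \ot avg) * Delta0 (vsval b) * (avg \ot avg)).

Lemma hecke_Delta_linear : linear hecke_Delta.
Proof.
move=> k x y; rewrite /hecke_Delta !linearP /= mulrDr mulrDl -scalerAr -scalerAl.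
by rewrite linearP.
Qed.
HB.instance Definition _ := GRing.isLinear.Build C (subvs_of hecke)
  (tens (subvs_of hecke) (subvs_of hecke)) _ hecke_Delta hecke_Delta_linear.

Lemma val_hecke_star b : vsval (hecke_star b) = gstar (vsval b).
Proof.
rewrite vsprojK //; have /hecke_spaceP[c ->] := subvsP b.
apply/hecke_spaceP; exists (gstar c).
by rewrite /compress !gstarM gstar_avg mulrA.
Qed.

Lemma val_hecke_Delta b :
  tmap vsval vsval (hecke_Delta b)
  = (avg \ot avg) * Delta0 (vsval b) * (avg \ot avg).
Proof.
rewrite /hecke_Delta; elim/tens_ind: (Delta0 _) => [|k s t IHs IHt|c d].
- by rewrite mulr0 mul0r !linear0.
- by rewrite mulrDr mulrDl -scalerAr -scalerAl !linearP /= IHs IHt.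
rewrite !tpureM !tmapE /= !vsprojK //; apply/hecke_spaceP.
  by exists d.
by exists c.
Qed.

End Hecke.

(* Main.v *)
From HB Require Import structures.
From mathcomp Require Import all_boot all_order all_fingroup all_algebra all_field.
From mathcomp Require Import complex reals.
Require Import Defs.

(** The elements [hbasis p = u * lam p * u] span the compressed algebra and are
   group-like, since [lam p \ot lam p] is multiplicative in [p] and [u] absorbs
   [lam h] for [h] in [H].  So linear identities need only be tested on them:
   the counit is the sum of coefficients, and the integral [phi] is the
   coefficient at [1].  Because [hbasis p] is supported on the double coset
   [H p H], [phi (hbasis p * hbasis q)] vanishes unless
   [hbasis q = hbasis p^-1], which makes [hbasis p |-> hbasis p^-1] the
   antipode.  Faithfulness is positivity of [phi (x * gstar x)]. *)

Set Implicit Arguments.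
Unset Strict Implicit.
Unset Printing Implicit Defensive.

Import Order.TTheory GRing.Theory Num.Theory.
Local Open Scope ring_scope.

Lemma tpure0r (K : fieldType) (U V : vectType K) (u : U) : u \ot (0 : V) = 0.
Proof.
by have := tpure_linearr u (-1) (0 : V) 0; rewrite scaler0 addr0 scaleN1r addNr.
Qed.

(** * Inversion and the augmentation character of the group algebra *)

Section GroupAlgebraInverse.
Variables (C : fieldType) (gT : finGroupType).
Implicit Types x y : grAlg C gT.

Lemma coef_is_scalar g : scalar (fun x => coef x g).
Proof. by move=> k x y; rewrite coefD coefZ. Qed.

(** The support of a product lies in the product of the supports. This turns nonvanishing of the
    integral into a factorization in the group. *)
Lemma coefM_neq0 x y g : coef (x * y) g != 0 ->
  exists2 h, coef x h != 0 & coef y (h^-1 * g)%g != 0.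
Proof.
have [/exists_inP[h]|/exists_inPn all0] :=
    boolP [exists (h | coef x h != 0), coef y (h^-1 * g)%g != 0].
  by exists h.
rewrite coefM big1 ?eqxx // => h _; have [->|nz] := eqVneq (coef x h) 0.
  by rewrite mul0r.
by have := all0 h nz; rewrite negbK => /eqP ->; rewrite mulr0.
Qed.

(** The linear counterpart of [gstar], without conjugation: an antipode has to be linear, so the
    antilinear star cannot serve. *)
Definition ginv x : grAlg C gT := [ffun g => coef x g^-1 : C^o].

Lemma coef_ginv x g : coef (ginv x) g = coef x g^-1.
Proof. by rewrite /coef ffunE. Qed.

Lemma ginv_is_linear : linear ginv.
Proof. by move=> k x y; apply: grAlgP => g; rewrite coefD coefZ !coef_ginv coefD coefZ. Qed.

Lemma ginvK : involutive ginv.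
Proof. by move=> x; apply: grAlgP => g; rewrite !coef_ginv invgK. Qed.

Lemma ginv_lam p : ginv (lam p) = lam p^-1.
Proof.
by apply: grAlgP => g; rewrite coef_ginv !coef_lam (can2_eq invgK invgK).
Qed.

Lemma ginvM x y : ginv (x * y) = ginv y * ginv x.
Proof.
apply: grAlgP => g; rewrite coef_ginv !coefM (reindex_inj (mulgI g^-1%g)) /=.
by apply: eq_bigr => h _; rewrite !coef_ginv !invMg !invgK mulrC mulgK.
Qed.

Definition gsum x : C := \sum_g coef x g.

Lemma gsum_is_scalar : scalar gsum.
Proof.
move=> k x y; rewrite /gsum mulr_sumr -big_split /=.
by apply: eq_bigr => g _; rewrite coefD coefZ.
Qed.

HB.instance Definition _ :=
  GRing.isLinear.Build C (grAlg C gT) C *%R gsum gsum_is_scalar.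

Lemma gsum_lam p : gsum (lam p) = 1.
Proof.
rewrite /gsum (bigD1 p) //= big1 => [|g /negbTE ng]; rewrite coef_lam ?ng //.
by rewrite eqxx addr0.
Qed.

Lemma gsumM x y : gsum (x * y) = gsum x * gsum y.
Proof.
rewrite /gsum; under eq_bigr => g _ do rewrite coefM.
rewrite exchange_big mulr_suml; apply: eq_bigr => h _ /=.
rewrite (reindex_inj (mulgI h)) mulr_sumr; apply: eq_bigr => g _.
by rewrite mulKg.
Qed.

End GroupAlgebraInverse.

(** * The involution of the group algebra and its positivity *)

Section StarGroupAlgebra.
Variables (C : numClosedFieldType) (gT : finGroupType).
Implicit Types x y : grAlg C gT.

Lemma gstarK : involutive (@gstar C gT).
Proof. by move=> x; apply: grAlgP => g; rewrite !coef_gstar invgK conjCK. Qed.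

Lemma gstar_antilinear (k : C) x y : gstar (k *: x + y) = k^* *: gstar x + gstar y.
Proof.
apply: grAlgP => g.
by rewrite coefD coefZ !coef_gstar coefD coefZ rmorphD rmorphM.
Qed.

(** The coefficient at 1 is the sum of the squared moduli of the coefficients of [x], so each of
    them vanishes. *)
Lemma mul_gstar_eq0 x : coef (x * gstar x) 1%g = 0 -> x = 0.
Proof.
rewrite coefM => sum0; apply: grAlgP => g; rewrite [RHS]ffunE.
have ge0 h : 0 <= coef x h * coef (gstar x) (h^-1 * 1)%g.
  by rewrite mulg1 coef_gstar invgK mul_conjC_ge0.
have /eqP : coef x g * coef (gstar x) (g^-1 * 1)%g = 0.
  exact: (psumr_eq0P (fun h _ => ge0 h) sum0).
by rewrite mulg1 coef_gstar invgK mul_conjC_eq0 => /eqP.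
Qed.

End StarGroupAlgebra.

(** * A group-like spanning family of the compressed algebra *)

Section HeckeQuantumHypergroup.
Variables (C : numClosedFieldType) (gT : finGroupType) (H : {group gT}).
Local Notation B := (subvs_of (hecke C H)).
Local Notation u := (avg C H).
Implicit Types (p q : gT) (a b c : B).

Lemma avg_lam h : h \in H -> u * lam h = u.
Proof.
move=> Hh; apply: (can_inj (@gstarK C gT)).
by rewrite gstarM gstar_lam gstar_avg lam_avg ?groupV.
Qed.

(** Indexed by group elements rather than by double cosets, hence a spanning family with repetitions
    and not literally a basis. *)
Definition hbasis p : B := vsproj (hecke C H) (u * lam p * u).

Lemma val_hbasis p : vsval (hbasis p) = u * lam p * u.
Proof. by rewrite vsprojK //; apply/hecke_spaceP; exists (lam p). Qed.

Lemma vsval_inj : injective (@vsval _ _ (hecke C H)).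
Proof. exact: val_inj. Qed.

Lemma val_heckeM a b : vsval (a * b) = vsval a * vsval b.
Proof. by []. Qed.

Lemma hbasis1 : hbasis 1 = 1.
Proof. by apply: vsval_inj; rewrite val_hbasis lam1 mulr1 avg_idem val_hecke1. Qed.

Lemma hbasis_double_coset h p k :
  h \in H -> k \in H -> hbasis (h * p * k) = hbasis p.
Proof.
move=> Hh Hk; apply: vsval_inj; rewrite !val_hbasis -!lamM.
by rewrite -!mulrA lam_avg // !mulrA avg_lam.
Qed.

(** Every element is fixed by [compress], so compressing its expansion in the [lam p] writes it as a
    combination of the [hbasis p]. *)
Lemma hecke_ind (P : B -> Prop) :
  P 0 -> (forall k a b, P a -> P b -> P (k *: a + b)) ->
  (forall p, P (hbasis p)) -> forall b, P b.
Proof.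
move=> P0 Plin Pb b.
have -> : b = \sum_p coef (vsval b) p *: hbasis p.
  apply: vsval_inj; rewrite linear_sum /=.
  have /hecke_spaceP[c bE] := subvsP b.
  have [bul bur] := compressK H c; rewrite -bE in bul bur.
  have {1}-> : vsval b = compress H (vsval b) by rewrite /compress bul bur.
  rewrite [X in compress _ X]grAlgE linear_sum.
  by apply: eq_bigr => p _; rewrite linearZ /= val_hbasis.
apply: big_ind => [//|x y Px Py|p _]; first by rewrite -[x]scale1r; apply: Plin.
by rewrite -[_ *: _]addr0; apply: Plin.
Qed.

Lemma hecke_Delta_hbasis p : hecke_Delta (hbasis p) = hbasis p \ot hbasis p.
Proof.
rewrite /hecke_Delta val_hbasis.
have -> : (u \ot u : tens _ _) * Delta0 (u * lam p * u) * (u \ot u)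
    = (u * lam p * u) \ot (u * lam p * u).
  (* [Delta0] is explicit on each [lam] only, so the element is spread out as an average over pairs
     in [H]. *)
  have {1}-> : u * lam p * u =
      \sum_(h in H) \sum_(k in H) (#|H|%:R^-1 * #|H|%:R^-1) *: lam (h * p * k) :> grAlg C gT.
    rewrite {1 2}/avg -!(scalerAl, scalerAr) !mulr_suml scaler_sumr.
    rewrite scaler_sumr; apply: eq_bigr => h _; rewrite lamM mulr_sumr.
    by rewrite !scaler_sumr; apply: eq_bigr => k _; rewrite lamM scalerA.
  rewrite linear_sum mulr_sumr mulr_suml.
  under eq_bigr => h Hh.
    rewrite linear_sum mulr_sumr mulr_suml.
    under eq_bigr => k Hk.
      rewrite linearZ /= Delta0_lam -scalerAr -scalerAl !tpureM.
      (* After compression no summand depends on [h] or [k] any more, and the average collapses to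
         one term. *)
      rewrite -!val_hbasis hbasis_double_coset //.
      over.
    rewrite sumr_const; over.
  rewrite sumr_const -!scaler_nat !scalerA val_hbasis.
  by rewrite mulrACA !mulfV ?mul1r ?scale1r // pnatr_eq0 -lt0n cardG_gt0.
by rewrite tmapE /hbasis.
Qed.

(** * The counit and its multiplicativity *)

Lemma hecke_eps_is_scalar : scalar (fun b => gsum (vsval b)).
Proof. by move=> k a b; rewrite /= gsum_is_scalar. Qed.

Definition hecke_eps b : C := gsum (vsval b).
HB.instance Definition _ :=
  GRing.isLinear.Build C B C *%R hecke_eps hecke_eps_is_scalar.

Lemma hecke_eps_hbasis p : hecke_eps (hbasis p) = 1.
Proof.
have gsum_avg : gsum u = 1.
  rewrite /avg linearZ linear_sum /=; under eq_bigr => h _ do rewrite gsum_lam.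
  by rewrite sumr_const mulVf // pnatr_eq0 -lt0n cardG_gt0.
by rewrite /hecke_eps val_hbasis !gsumM gsum_lam gsum_avg !mul1r.
Qed.

Lemma hbasis_neq0 p : hbasis p != 0.
Proof.
by apply/eqP => e0; have /eqP := hecke_eps_hbasis p; rewrite e0 linear0 eq_sym oner_eq0.
Qed.

Lemma hecke_epsP : counit (@hecke_Delta C gT H) hecke_eps.
Proof.
elim/hecke_ind => [|k a b [al ar] [bl br]|p]; first by rewrite !linear0.
  by rewrite !linearP /= al ar bl br.
by rewrite /= hecke_Delta_hbasis tslicelE tslicerE /= hecke_eps_hbasis scale1r.
Qed.

(** On a group-like [x] the counit law reads [eps x *: x = x], and [x] is nonzero. This pins down
    every counit, as the definition quantifies over all of them. *)
Lemma hecke_counit_hbasis (eps : {scalar B}) p :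
  counit (@hecke_Delta C gT H) eps -> eps (hbasis p) = 1.
Proof.
move=> /(_ (hbasis p))[]; rewrite /= hecke_Delta_hbasis tslicelE => /eqP e _.
apply/eqP; move: e; rewrite -subr_eq0 -[X in _ - X]scale1r -scalerBl scaler_eq0.
by rewrite subr_eq0 (negbTE (hbasis_neq0 p)) orbF.
Qed.

Lemma hecke_counit_morphism (eps : {scalar B}) :
  counit (@hecke_Delta C gT H) eps -> monoid_morphism eps.
Proof.
move=> epsP; have epsE : eps =1 hecke_eps.
  elim/hecke_ind => [|k a b IHa IHb|p]; first by rewrite !linear0.
    by rewrite !linearP IHa IHb.
  by rewrite hecke_counit_hbasis // hecke_eps_hbasis.
split; first by rewrite -hbasis1 hecke_counit_hbasis.
by move=> a b; rewrite !epsE -gsumM.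
Qed.

(** * The integral, the star operation and faithfulness *)

Lemma hecke_phi_is_scalar : scalar (fun b => coef (vsval b) 1%g).
Proof. by move=> k a b; rewrite /= coef_is_scalar. Qed.

Definition hecke_phi b : C := coef (vsval b) 1%g.
HB.instance Definition _ :=
  GRing.isLinear.Build C B C *%R hecke_phi hecke_phi_is_scalar.

Lemma hecke_phi_star a : hecke_phi (a * hecke_star a) = 0 -> a = 0.
Proof.
rewrite /hecke_phi val_heckeM val_hecke_star => /mul_gstar_eq0 a0.
exact: vsval_inj.
Qed.

Lemma hecke_starK : involutive (@hecke_star C gT H).
Proof. by move=> a; apply: vsval_inj; rewrite !val_hecke_star gstarK. Qed.

Lemma hecke_star_operation : star_operation (@hecke_star C gT H).
Proof.
split; last exact: hecke_starK.
  move=> k a b; apply: vsval_inj.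
  by rewrite linearP /= !val_hecke_star linearP gstar_antilinear.
by move=> a b; apply: vsval_inj; rewrite val_heckeM !val_hecke_star val_heckeM gstarM.
Qed.

Lemma hecke_star0 : hecke_star 0 = 0 :> B.
Proof.
have [sl _ _] := hecke_star_operation.
by have := sl (-1) 0 0; rewrite scaler0 addr0 rmorphN1 scaleN1r addNr.
Qed.

Lemma hecke_star_hbasis p : hecke_star (hbasis p) = hbasis p^-1.
Proof.
apply: vsval_inj; rewrite val_hecke_star !val_hbasis !gstarM gstar_lam gstar_avg.
by rewrite mulrA.
Qed.

Lemma hecke_phi_faithful : faithful hecke_phi.
Proof.
split=> [a phi0|c phi0]; first exact/hecke_phi_star/phi0.
(* Testing against the star of [c] reduces the second half of faithfulness to positivity at
   [hecke_star c]. *)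
rewrite -[c]hecke_starK (_ : hecke_star c = 0) ?hecke_star0 //.
by apply: hecke_phi_star; rewrite hecke_starK.
Qed.

(** * The antipode: existence and uniqueness *)

Definition hecke_inv b : B := vsproj (hecke C H) (ginv (vsval b)).

Lemma hecke_inv_is_linear : linear hecke_inv.
Proof. by move=> k a b; rewrite /hecke_inv !linearP /= ginv_is_linear linearP. Qed.
HB.instance Definition _ :=
  GRing.isLinear.Build C B B _ hecke_inv hecke_inv_is_linear.

Lemma ginv_avg : ginv u = u.
Proof. by apply: grAlgP => g; rewrite coef_ginv !coef_avg groupV. Qed.

Lemma val_hecke_inv b : vsval (hecke_inv b) = ginv (vsval b).
Proof.
rewrite vsprojK //; have /hecke_spaceP[c ->] := subvsP b.
by apply/hecke_spaceP; exists (ginv c); rewrite /compress !ginvM ginv_avg mulrA.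
Qed.

Lemma hecke_invK : involutive hecke_inv.
Proof. by move=> a; apply: vsval_inj; rewrite !val_hecke_inv ginvK. Qed.

Lemma hecke_invM a b : hecke_inv (a * b) = hecke_inv b * hecke_inv a.
Proof. by apply: vsval_inj; rewrite val_heckeM !val_hecke_inv val_heckeM ginvM. Qed.

Lemma hecke_inv_hbasis p : hecke_inv (hbasis p) = hbasis p^-1.
Proof.
apply: vsval_inj; rewrite val_hecke_inv !val_hbasis !ginvM ginv_lam ginv_avg.
by rewrite mulrA.
Qed.

Lemma coef_hbasis_neq0 p g : coef (vsval (hbasis p)) g != 0 -> hbasis g = hbasis p.
Proof.
move=> nz; suff [h [k [Hh Hk ->]]] : exists h k, [/\ h \in H, k \in H & g = (h * p * k)%g].
  exact: hbasis_double_coset.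
have avg_nz r : coef u r != 0 -> r \in H.
  by rewrite coef_avg; apply: contraR => /negbTE ->; rewrite mul0r.
have lam_nz r t : coef (lam r : grAlg C gT) t != 0 -> t = r.
  by rewrite coef_lam; apply: contra_neq_eq => /negbTE ->.
move: nz; rewrite val_hbasis => /coefM_neq0[r /coefM_neq0[h /avg_nz Hh /lam_nz <-] /avg_nz Hk].
by exists h, (r^-1 * g)%g; split=> //; rewrite !mulKVg.
Qed.

(** Some [g] lies in the support of [hbasis p] with its inverse in that of [hbasis q]; both double
    cosets are then read off from [g]. *)
Lemma hecke_phi_hbasisM p q :
  hecke_phi (hbasis p * hbasis q) != 0 -> hbasis q = hbasis p^-1.
Proof.
rewrite /hecke_phi val_heckeM => /coefM_neq0[g pg qg].
by rewrite -(coef_hbasis_neq0 qg) mulg1 -!hecke_inv_hbasis (coef_hbasis_neq0 pg).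
Qed.

Lemma hecke_phi_hbasisMV p : hecke_phi (hbasis p * hbasis p^-1) != 0.
Proof.
rewrite -hecke_star_hbasis; apply/eqP => /hecke_phi_star /eqP.
exact/negP/hbasis_neq0.
Qed.

Lemma hecke_slice_hbasis p q :
  (tslicer hecke_phi (hecke_Delta (hbasis p) * ((1 : B) \ot hbasis q))
    = hecke_phi (hbasis p * hbasis q) *: hbasis p) *
  (tslicer hecke_phi (((1 : B) \ot hbasis p) * hecke_Delta (hbasis q))
    = hecke_phi (hbasis p * hbasis q) *: hbasis q).
Proof. by rewrite !hecke_Delta_hbasis !tpureM !tslicerE mulr1 mul1r. Qed.

Lemma hecke_inv_antipode : antipode (@hecke_Delta C gT H) hecke_phi hecke_inv.
Proof.
move=> a c; elim/hecke_ind: a => [|k a b IHa IHb|p].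
- by rewrite tpure0r mul0r !linear0 mul0r !linear0.
- rewrite tpure_linearr mulrDl -scalerAl !linearP mulrDl -scalerAl !linearP.
  by congr (_ *: _ + _).
elim/hecke_ind: c => [|k a b IHa IHb|q].
- by rewrite tpure0r mulr0 !linear0 mulr0 linear0.
- rewrite tpure_linearr mulrDr -scalerAr !linearP mulrDr -scalerAr !linearP.
  by rewrite IHa IHb.
rewrite /= !hecke_slice_hbasis linearZ /= hecke_inv_hbasis.
(* Both sides carry the same scalar factor; when it is nonzero, the vectors it multiplies agree. *)
have [->|/hecke_phi_hbasisM ->] := eqVneq (hecke_phi (hbasis p * hbasis q)) 0.
  by rewrite !scale0r.
by [].
Qed.

(** For [q = p^-1] the scalar in both slices is nonzero and can be cancelled, which determines [S]
    on each [hbasis p]. *)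
Lemma hecke_antipode_unique (S : {linear B -> B}) :
  antipode (@hecke_Delta C gT H) hecke_phi S -> S =1 hecke_inv.
Proof.
move=> SP; elim/hecke_ind => [|k a b IHa IHb|p]; first by rewrite !linear0.
  by rewrite !linearP IHa IHb.
have := SP (hbasis p) (hbasis p^-1); rewrite /= !hecke_slice_hbasis linearZ.
by move/(scalerI (hecke_phi_hbasisMV p)) ->; rewrite hecke_inv_hbasis.
Qed.

(** * Coassociativity, the collected axioms and compatibility with the star *)

Lemma hecke_coassociative : coassociative (@hecke_Delta C gT H).
Proof.
elim/hecke_ind => [|k a b IHa IHb|p]; first by rewrite !linear0.
  by rewrite !linearP; congr (_ *: _ + _).
by rewrite /= !hecke_Delta_hbasis !tmapE /= !hecke_Delta_hbasis tassocE.
Qed.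

Lemma hecke_finite_quantum_hypergroup :
  finite_quantum_hypergroup (@hecke_Delta C gT H).
Proof.
split.
- exact: hecke_coassociative.
- by exists hecke_eps; apply: hecke_epsP.
- by rewrite -hbasis1 /= hecke_Delta_hbasis.
- exact: hecke_counit_morphism.
exists hecke_phi; split; first exact: hecke_phi_faithful.
  by exists hecke_inv; apply: hecke_inv_antipode.
move=> S /hecke_antipode_unique SE; split.
  by exists S => a; rewrite !SE hecke_invK.
by move=> a b; rewrite !SE hecke_invM.
Qed.

Lemma hecke_Delta_star a :
  hecke_Delta (hecke_star a) = tstar (@hecke_star C gT H) (hecke_Delta a).
Proof.
have [sl _ _] := hecke_star_operation.
(* Both sides of the goal are antilinear in [a]; knowing this for [tstar] lets [hecke_ind] apply. *)
have tl (k : C) (x y : tens B B) : tstar (@hecke_star C gT H) (k *: x + y)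
    = k^* *: tstar (@hecke_star C gT H) x + tstar (@hecke_star C gT H) y.
  rewrite /tstar scaler_sumr -big_split; apply: eq_bigr => i _ /=.
  rewrite scaler_sumr -big_split; apply: eq_bigr => j _ /=.
  by rewrite !mxE rmorphD rmorphM scalerDl scalerA.
have t0 : tstar (@hecke_star C gT H) 0 = 0.
  by have := tl (-1) 0 0; rewrite scaler0 addr0 rmorphN1 scaleN1r addNr.
elim/hecke_ind: a => [|k a b IHa IHb|p]; first by rewrite hecke_star0 linear0 t0.
  by rewrite sl !linearP tl -IHa -IHb.
rewrite hecke_star_hbasis !hecke_Delta_hbasis tstarE ?hecke_star_hbasis //.
exact: hecke_star_operation.
Qed.

End HeckeQuantumHypergroup.

Theorem theorem4p8 (R : realType) (gT : finGroupType) (H : {group gT}) :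
  @finite_star_quantum_hypergroup R[i] (subvs_of (hecke R[i] H))
    (@hecke_star R[i] gT H) (@hecke_Delta R[i] gT H).
Proof.
split; first exact: hecke_finite_quantum_hypergroup.
  exact: hecke_star_operation.
exact: hecke_Delta_star.
Qed.
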